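(* Let $n\ge1$. Let $D$ be a weighted oriented graph with $V^+\neq\emptyset$ in which all elements of $V^+$ are sinks, and whose underlying graph $G$ is a clique sum of two odd cycles $C_{2n+1}=(x_1,x_2,\dots,x_{2n+1})$ and $C'_{2n+1}=(x_1,y_2,\dots,y_{2n+1})$ of the same length with a common vertex $x_1$. Let $\tilde I=I(D)$ be the edge ideal of $D$, and let $$c=\Bigl(\prod_{v\in V(C_{2n+1})\setminus V^+}v\Bigr)\Bigl(\prod_{v\in V(C_{2n+1})\cap V^+}v^{w(v)}\Bigr),\qquad c'=\Bigl(\prod_{v\in V(C'_{2n+1})\setminus V^+}v\Bigr)\Bigl(\prod_{v\in V(C'_{2n+1})\cap V^+}v^{w(v)}\Bigr).$$ Then: (1) $\tilde I^{(s)}=\tilde I^{\,s}$ for $1\le s\le n$, and $\tilde I^{(n+1)}=\tilde I^{\,n+1}+(c)+(c')$. (2) Let $s\in\mathbb{N}$ and write $s=k(n+1)+r$ with $k\in\mathbb{Z}$ and $0\le r\le n$. Then $$\tilde I^{(s)}=\sum_{t=0}^{k}\ \sum_{\substack{p,q\ge0\\ p+q=t}}\tilde I^{\,s-t(n+1)}(c)^p(c')^q.$$ (3) If exactly one of the two cycles does not contain any element of $V^+$, then $\alpha(\tilde I^{(s)})=2s-\left\lfloor\frac{s}{n+1}\right\rfloor$ for all $s\in\mathbb{N}$. In particular, the Waldschmidt constant of $\tilde I$ is $\widehat{\alpha}(\tilde I)=\frac{2n+1}{n+1}$. (4) If both cycles contain some element of $V^+$, then $\alpha(\tilde I^{(s)})=2s$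 for all $s\in\mathbb{N}$. In particular, the Waldschmidt constant of $\tilde I$ is $\widehat{\alpha}(\tilde I)=2$.
   Context: A weighted oriented graph $D=(V(D),E(D),w)$ consists of a finite simple graph $G$ (the underlying graph) with $V(G)=V(D)$, an orientation of each edge of $G$ (the pair $(x,y)\in E(D)$ denotes the edge directed from $x$ to $y$), and a weight function $w:V(D)\to\mathbb{N}=\{1,2,\dots\}$. If $x$ is a source (only arrows leaving $x$), one always assumes $w(x)=1$. Set $V^+=\{x\in V(D): w(x)\neq 1\}$. A vertex $x$ is a sink if all edges at $x$ are directed into $x$. Let $R$ be the polynomial ring over a field $K$ whose variables are the vertices of $D$. The edge ideal of $D$ is $I(D)=(xy^{w(y)} : (x,y)\in E(D))\subseteq R$. That $G$ is the clique sum of the two cycles with common vertex $x_1$ means that $G$ is the union of the two cycles, which share exactly the vertex $x_1$ and no edges; so $G$ has the $4n+1$ vertices $x_1,\dots,x_{2n+1},y_2,\dots,y_{2n+1}$. For a homogeneous ideal $I\subset R$, the $m$-th symbolic power is $I^{(m)}=\bigcap_{p\in \mathrm{Ass}(I)}(I^mR_p\cap R)$, the intersection being over all associated primes of $I$; any ideal to the power $0$ is $R$. For a nonzero homogeneous ideal $I$, $\alpha(I)=\min\{d: I_d\neq0\}$ is the smallest degree of a nonzero element of $I$ (with the standard grading), and the Waldschmidt constant is $\widehat{\alpha}(I)=\lim_{s\to\infty}\alpha(I^{(s)})/s$. *)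

(* Defs.v *)
From HB Require Import structures.
From mathcomp Require Import all_boot all_order all_algebra.
(* [mpoly] has to be imported before the analysis files: in the other order
   their notations conflict. *)
From mathcomp Require Import mpoly.
From mathcomp Require Import boolp classical_sets reals topology normedtype.
From mathcomp Require Import sequences.

Set Implicit Arguments.
Unset Strict Implicit.
Unset Printing Implicit Defensive.

Import Order.TTheory GRing.Theory Num.Theory.
Import numFieldNormedType.Exports.

Local Open Scope classical_set_scope.
Local Open Scope ring_scope.

(* Ideals are classical sets, so that the improper ideal [setT] and equality
   of ideals as sets are available; the ideals of ring_quotient are proper and
   carried by boolean predicates. *)

Section Ideals.
Variable A : comNzRingType.
Implicit Types (I J P S : set A).

(* The set of finite combinations of elements of S with coefficients in B;
   it is the B-submodule generated by S when B is a subring of A. *)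
Definition lin_span (B S : set A) : set A :=
  [set f | exists (m : nat) (b g : 'I_m -> A),
     (forall i, B (b i) /\ S (g i)) /\ f = \sum_(i < m) b i * g i].

Definition ideal_gen S : set A := lin_span setT S.

Definition principal (f : A) : set A := ideal_gen [set f].

Definition idealD I J : set A := [set f + g | f in I & g in J].

Definition idealM I J : set A := ideal_gen [set f * g | f in I & g in J].

Definition idealX I (m : nat) : set A := iter m (idealM I) setT.

Definition is_ideal I : Prop :=
  I 0 /\ forall a f g, I f -> I g -> I (a * f + g).

Definition is_prime_ideal P : Prop :=
  [/\ is_ideal P, ~ P 1 & forall f g, P (f * g) -> P f \/ P g].

(* P is the annihilator of the class of some f in A / I. *)
Definition associated_prime I P : Prop :=
  is_prime_ideal P /\ exists f, P = [set g | I (g * f)].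

End Ideals.

Section Symbolic.
Variable A : idomainType.
Implicit Types (I J P : set A).

(* The localization at a prime P of the domain A, as a subring of the fraction
   field of A. *)
Definition localization P : set {fraction A} :=
  [set x | exists f g, ~ P g /\ x = tofrac f / tofrac g].

(* The ideal J A_P of A_P. *)
Definition loc_extension P J : set {fraction A} :=
  lin_span (localization P) (@tofrac A @` J).

Definition loc_contraction P J : set A :=
  @tofrac A @^-1` loc_extension P J.

Definition symbolic_power I (m : nat) : set A :=
  \bigcap_(P in [set P | associated_prime I P])
     loc_contraction P (idealX I m).

End Symbolic.

Section InitialDegree.
Variables (N : nat) (K : fieldType).
Implicit Type I : set {mpoly K[N]}.

Definition nonzero_in_degree I (d : nat) : Prop :=
  exists f : {mpoly K[N]}, [/\ I f, f \is d.-homog & f != 0].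

(* The default value 0 is only taken when I contains no nonzero homogeneous
   element. *)
Definition alpha I : nat :=
  xget 0%N [set d | nonzero_in_degree I d /\
                    forall e, nonzero_in_degree I e -> (d <= e)%N].

Definition has_waldschmidt_constant (R : realType) I (l : R) : Prop :=
  ((alpha (symbolic_power I s))%:R / s%:R : R) @[s --> \oo] --> l.

End InitialDegree.

(* Asymmetry of the arc relation (which implies irreflexivity) says that it is
   an orientation of each edge of a simple graph. *)
Record weighted_oriented_graph (V : finType) := WeightedOrientedGraph {
  arc : rel V;
  weight : V -> nat;
  arc_asym : forall u v, arc u v -> ~~ arc v u;
  weight_gt0 : forall v, (0 < weight v)%N;
  weight_source : forall v, (forall u, ~~ arc u v) -> weight v = 1%N
}.

Section Graphs.
Variable V : finType.
Implicit Type D : weighted_oriented_graph V.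

Definition adj D : rel V := fun u v => arc D u v || arc D v u.

Definition Vplus D : pred V := [pred v | weight D v != 1%N].

Definition sink D (v : V) : Prop := forall u, ~~ arc D v u.

(* [ordS] is the successor modulo m. *)
Definition cycle_edge m (x : 'I_m -> V) (u v : V) : Prop :=
  exists i, (u = x i /\ v = x (ordS i)) \/ (v = x i /\ u = x (ordS i)).

(* The underlying graph of D is the union of the cycles (x_0, .., x_2n) and
   (y_0, .., y_2n), which meet exactly in x_0 = y_0. *)
Definition clique_sum_of_odd_cycles D n (x y : 'I_(2 * n).+1 -> V) : Prop :=
  [/\ injective x /\ injective y,
      forall i j, x i = y j <-> i = ord0 /\ j = ord0,
      forall v, (v \in codom x) || (v \in codom y) &
      forall u v, adj D u v <-> cycle_edge x u v \/ cycle_edge y u v].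

End Graphs.

Section EdgeIdeal.
Variables (K : fieldType) (V : finType).
Implicit Type D : weighted_oriented_graph V.

Definition var (v : V) : {mpoly K[#|V|]} := 'X_(enum_rank v).

Definition edge_ideal D : set {mpoly K[#|V|]} :=
  ideal_gen [set f | exists u v, arc D u v /\ f = var u * var v ^+ weight D v].

Definition cycle_monomial D m (x : 'I_m -> V) : {mpoly K[#|V|]} :=
  (\prod_(v in codom x | v \notin Vplus D) var v) *
  (\prod_(v in codom x | v \in Vplus D) var v ^+ weight D v).

End EdgeIdeal.

Arguments edge_ideal K [V] D _.
Arguments cycle_monomial K [V] D [m] x.

(* Main.v *)
Require Import Defs.
From mathcomp Require Import all_boot all_order all_algebra zify ring.
From mathcomp Require Import mpoly.
From mathcomp Require Import boolp classical_sets reals topology normedtype.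
From mathcomp Require Import sequences.

(** Since the vertices of weight > 1 are sinks, I(D) is obtained from the edge
    ideal of the underlying graph by substituting v ^ w(v) for v. Its associated
    primes are therefore the primes P_C of the minimal vertex covers C, and an
    element of the s-th symbolic power is a combination of monomials whose
    exponents, divided by the weights and rounded down, have sum at least s on
    every vertex cover. What remains is combinatorial: vertex weights for which
    every cover has weight at least s must dominate a packing of p + q cycles and
    E edges with E + (n + 1)(p + q) >= s. For one odd cycle this goes by
    induction on the length, folding a vertex of largest weight together with
    its two neighbours; for two cycles one splits the weight of the common
    vertex between them. Conversely, a cycle monomial times a vertex of the
    cycle is a product of n + 1 edges, and no associated prime contains all the
    vertices of a cycle. *)

Set Implicit Arguments.
Unset Strict Implicit.
Unset Printing Implicit Defensive.

Import Order.TTheory GRing.Theory Num.Theory.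
Import numFieldNormedType.Exports.

(** * Packings and covers of odd cycles *)

Definition periodic (T : Type) (m : nat) (f : nat -> T) :=
  forall i, f (i + m) = f i.

Lemma periodicE T m (f : nat -> T) i : periodic m f -> f i = f (i %% m).
Proof.
move=> fP; rewrite {1}(divn_eq i m); elim: (i %/ m) => [|k IHk] //.
by rewrite mulSn -addnA [m + _]addnC fP.
Qed.

Lemma periodic_modn T m (f : nat -> T) : periodic m (fun i => f (i %% m)).
Proof. by move=> i; rewrite modnDr. Qed.

Lemma periodic_add T m (f : nat -> T) k :
  periodic m f -> periodic m (fun i => f (i + k)).
Proof. by move=> fP i; rewrite addnAC fP. Qed.

Lemma big_periodic (R : Type) (idx : R) (op : Monoid.com_law idx) m
    (f : nat -> R) k : periodic m f ->
  \big[op/idx]_(i < m) f (i + k) = \big[op/idx]_(i < m) f i.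
Proof.
move=> fP; elim: k => [|k <-]; first by apply: eq_bigr => i _; rewrite addn0.
case: m fP => [|m] fP; first by rewrite !big_ord0.
rewrite big_ord_recr [in RHS]big_ord_recl /= Monoid.mulmC add0n.
have -> : m + k.+1 = k + m.+1 by lia.
by rewrite fP; congr (op _ _); apply: eq_bigr => i _; rewrite /bump /= addnS.
Qed.

Lemma modnS_cases m r : r < m -> r.+1 %% m = if r.+1 == m then 0 else r.+1.
Proof.
move=> rm; case: eqP => [->|]; first by rewrite modnn.
by move=> ?; rewrite modn_small //; lia.
Qed.

(* Folding: if [a 1] is the largest weight of the cycle, the vertices 0, 1, 2
   are merged into one vertex of weight [a 0 + a 2 - t] with
   [t = minn (a 1) (a 0 + a 2)]; this shortens the cycle by two and lowers
   both optimal values by [t]. *)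
Lemma odd_cycle_duality n (a : nat -> nat) s :
  periodic (2 * n).+1 a ->
  (forall c : nat -> bool, periodic (2 * n).+1 c ->
     (forall i, c i || c i.+1) -> s <= \sum_(i < (2 * n).+1) c i * a i) ->
  exists (p : nat) (y : nat -> nat),
    [/\ periodic (2 * n).+1 y, forall i, p + y i + y i.+1 <= a i.+1 &
        s <= n.+1 * p + \sum_(i < (2 * n).+1) y i].
Proof.
elim: n a s => [|n IHn] a s aP sP.
  (* For [n = 0] the cycle is a loop: [a 0] copies of it exhaust the single vertex and no edge is
     used. *)
  exists (a 0), (fun=> 0); split=> // [i|].
    by rewrite !addn0 (periodicE i.+1 aP) modn1.
  by have := sP xpredT (fun=> erefl) (fun=> erefl); rewrite muln0 !big_ord1 /=; lia.
wlog a1_max : a aP sP / forall i, a i <= a 1.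
  move=> IH.
  set m := (2 * n.+1).+1 in aP sP IH *.
  have [i0 _ i0_max] : {i0 : 'I_m | true & forall i : 'I_m, a i <= a i0}.
    case: (@arg_maxnP _ (ord0 : 'I_m) xpredT (fun i => a i)) => // i _ iP.
    by exists i => // j; apply: iP.
  (* Since [1 + k = i0 + m], the shift by [k] moves the maximum to position 1; the shift by
     [k * m.-1] inverts it modulo [m]. *)
  pose k := i0 + m.-1.
  have k1 : a (1 + k) = a i0.
    by rewrite -(aP i0); congr a; rewrite /k /m; lia.
  have [||i|p [y [yP py sy]]] := IH (fun i => a (i + k)).
  - exact: periodic_add.
  - move=> c cP cC.
    have -> : \sum_(i < m) c i * a (i + k) =
              \sum_(i < m) c (i + k * m.-1) * a (i + k * m.-1 + k).
      rewrite (@big_periodic _ _ _ m (fun i => c i * a (i + k))) //.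
      by move=> i; rewrite cP addnAC aP.
    apply: (leq_trans (sP (fun i => c (i + k * m.-1)) _ _)).
    + exact: periodic_add.
    + by move=> i; rewrite addSn.
    apply: leq_sum => i _; rewrite [a i](periodicE _ aP).
    rewrite [a (_ + k)](periodicE _ aP).
    have -> : i + k * m.-1 + k = k * m + i by rewrite /m; nia.
    by rewrite modnMDl.
  - by rewrite k1 (periodicE (i + k) aP) (i0_max (Ordinal (ltn_pmod _ (ltn0Sn _)))).
  exists p, (fun i => y (i + k * m.-1)); split.
  - exact: periodic_add.
  - move=> i; rewrite addSn; apply: (leq_trans (py _)).
    rewrite (periodicE _ aP) [a i.+1](periodicE _ aP).
    have -> : (i + k * m.-1).+1 + k = k * m + i.+1 by rewrite /m; nia.
    by rewrite modnMDl.
  - by rewrite big_periodic.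
set t := minn (a 1) (a 0 + a 2).
pose h j := if j is j'.+1 then a (j'.+3) else a 0 + a 2 - t.
have mE : (2 * n.+1).+1 = (2 * n).+1.+2 by lia.
rewrite mE in aP sP *.
set m := (2 * n).+1 in IHn aP sP *.
have [||p [y [yP py sy]]] := IHn (fun i => h (i %% m)) (s - t).
- exact: periodic_modn.
- move=> c cP cC; rewrite leq_subLR.
  (* A cover [c] of the short cycle unfolds: if it contains the merged vertex, take 0 and 2;
     otherwise take the cheaper of 1 and the pair 0, 2, at cost [t]. *)
  pose b0 := c 0 || (a 0 + a 2 <= a 1).
  pose g j := if j is j'.+1 then (if j' is j''.+1 then (if j'' is 0 then b0 else c j'')
      else ~~ b0) else b0.
  have := sP (fun i => g (i %% m.+2)) (@periodic_modn _ _ _).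
  have gC i : g (i %% m.+2) || g (i.+1 %% m.+2).
    have im : i %% m.+2 < m.+2 by rewrite ltn_pmod.
    have -> : i.+1 %% m.+2 = (i %% m.+2).+1 %% m.+2.
      by rewrite -addn1 -[in RHS]addn1 modnDml.
    rewrite modnS_cases //.
    case: (i %% m.+2) im => [|[|j]] //= im.
    + by rewrite orbN.
    + by rewrite orNb.
    + have := cC j; case: eqP => [[jm]|_].
        have -> : c j.+1 = c 0 by rewrite jm -(cP 0).
        rewrite /= /b0; case: {jm im} j => [|j] /=.
          by rewrite orbb => ->.
        by case: (c j.+1) => //= ->.
      rewrite /= /b0; case: {im} j => [|j] //=.
      by case: (c 0) => //= ->; rewrite orbT.
  move=> /(_ gC) /leq_trans -> //.
  rewrite [X in _ + X]big_ord_recl !big_ord_recl /= !addnA.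
  apply: leq_add.
    rewrite /bump !leq0n !add1n /t /b0; case: (c 0); case: leqP => /= ?; lia.
  apply: leq_sum => -[i ilt] _; rewrite /bump !add1n !modn_small /m //=; lia.
(* Unfolding the packing: the edges 0-1 and 1-2 share [t - p] units, of which 0-1 receives [al], as
   many as vertex 0 has room for; vertex 2 can take the rest because [a 1] is maximal. The gain
   [t - p], plus [p] for the longer cycle, is [t]. *)
pose yl := y m.-1.
pose al := minn (t - p) (a 0 - p - yl).
pose g j := if j is j'.+1 then (if j' is j''.+1 then y j'' else t - p - al) else al.
have h0 := py m.-1; rewrite prednK // modnn /= in h0.
have ymy : y m = y 0 by rewrite -[m]add0n yP.
have [a01 a21] := (a1_max 0, a1_max 2).
have py0 : p + yl + y 0 <= a 0 + a 2 - t by rewrite -ymy.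
exists p, (fun i => g (i %% m.+2)); split.
- exact: periodic_modn.
- move=> i.
  have im : i %% m.+2 < m.+2 by rewrite ltn_pmod.
  have -> : i.+1 %% m.+2 = (i %% m.+2).+1 %% m.+2.
    by rewrite -addn1 -[in RHS]addn1 modnDml.
  rewrite modnS_cases // (periodicE i.+1 aP).
  have -> : i.+1 %% m.+2 = (i %% m.+2).+1 %% m.+2.
    by rewrite -addn1 -[in RHS]addn1 modnDml.
  rewrite modnS_cases //.
  case: (i %% m.+2) im => [|[|j]] //= im.
  + rewrite /al /t; lia.
  + rewrite /al /t; lia.
  + case: eqP => [[jm]|jm] /=.
      have -> : j = m.-1 by lia.
      rewrite /al /yl /t; lia.
    have := py j; rewrite modn_small //; lia.
- have gE : \sum_(i < m.+2) g (i %% m.+2) = t - p + \sum_(i < m) y i.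
    transitivity (\sum_(i < m.+2) g i).
      by apply: eq_bigr => i _; rewrite modn_small.
    rewrite !big_ord_recl /= addnA; congr (_ + _); rewrite /al; lia.
  rewrite gE; have : p <= t by rewrite /t; lia.
  lia.
Qed.

Lemma ex_least (P : nat -> Prop) :
  (exists k, P k) -> exists k, P k /\ forall l, P l -> k <= l.
Proof.
move=> [k Pk].
have exP : exists l, `[< P l >] by exists k; apply/asboolP.
case: (ex_minnP exP) => l /asboolP Pl lmin.
by exists l; split=> // j Pj; apply: lmin; apply/asboolP.
Qed.

Definition cycle_cover m (c : nat -> bool) :=
  periodic m c /\ forall i, c i || c i.+1.

(** [y i] counts the edge from [i] to [i.+1], so vertex [i.+1] lies on the edges counted by [y i]
    and [y i.+1] and on each of the [p] copies of the cycle. *)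
Definition cycle_packing m (a : nat -> nat) (p : nat) (y : nat -> nat) :=
  periodic m y /\ forall i, p + y i + y i.+1 <= a i.+1.

Definition set_apex m (a : nat -> nat) j i := if i %% m == 0 then j else a i.

(* The value [minn (j + A) B] of a cycle whose apex has weight [j] comes from
   distinguishing whether a cover contains the apex. *)
Lemma apex_duality n (a : nat -> nat) : 0 < n -> periodic (2 * n).+1 a ->
  exists A B, [/\ A <= B,
    forall b, exists c, [/\ cycle_cover (2 * n).+1 c, c 0 = b &
      \sum_(i < 2 * n) c i.+1 * a i.+1 = if b then A else B] &
    forall j, exists p y,
      cycle_packing (2 * n).+1 (set_apex (2 * n).+1 a j) p y /\
      minn (j + A) B <= n.+1 * p + \sum_(i < (2 * n).+1) y i].
Proof.
move=> n0 aP; set m := (2 * n).+1.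
pose rest (c : nat -> bool) := \sum_(i < 2 * n) c i.+1 * a i.+1.
have least b : exists t, (exists c, [/\ cycle_cover m c, c 0 = b & rest c = t])
    /\ forall c, cycle_cover m c -> c 0 = b -> t <= rest c.
  have [|t [Pt tmin]] := @ex_least
    (fun t => exists c, [/\ cycle_cover m c, c 0 = b & rest c = t]).
    case: b; first by exists (rest xpredT), xpredT.
    (* The cover omitting only the apex; [0 < n] excludes the loop. *)
    pose c i := i %% m != 0; exists (rest c), c; split=> //.
    split=> [i|i]; first by rewrite /c modnDr.
    have im : i %% m < m by rewrite ltn_pmod.
    have iS : i.+1 %% m = (i %% m).+1 %% m by rewrite -addn1 -[in RHS]addn1 modnDml.
    rewrite /c iS modnS_cases //.
    case: (i %% m) => [|k] //=; case: (1 =P m) => // m1; rewrite /m in m1; lia.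
  by exists t; split=> // c cC c0; apply: tmin; exists c.
have [A [[c [cC c0 cA]] Amin]] := least true.
have [B [[d [dC d0 dB]] Bmin]] := least false.
exists A, B; split.
(* Adding the apex to an optimal cover without it gives a cover with the same remaining weight,
   whence [A <= B]. *)
- have {}dC := dC; case: (dC) => dP dE.
  pose e i := d i || (i %% m == 0).
  have <- : rest e = B.
    rewrite -dB; apply: eq_bigr => i _; rewrite /e modn_small ?orbF //.
    by rewrite /m ltnS.
  apply: Amin; last by rewrite /e mod0n orbT.
  split=> i; rewrite /e ?dP ?modnDr //.
  by case/orP: (dE i) => ->; rewrite ?orbT.
- by case; [exists c | exists d].
- move=> j.
  have a'P : periodic m (set_apex m a j) by move=> i; rewrite /set_apex modnDr aP.
  have [e eP eC|p [y [yP py sy]]] := odd_cycle_duality (s := minn (j + A) B) a'P.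
    have -> : \sum_(i < m) e i * set_apex m a j i = e 0 * j + rest e.
      rewrite big_ord_recl /= {1}/set_apex mod0n eqxx; congr (_ + _).
      by apply: eq_bigr => i _; rewrite /set_apex /bump modn_small //= /m ltnS.
    case e0: (e 0).
      by rewrite mul1n; apply: leq_trans (geq_minl _ _) _; rewrite leq_add2l Amin.
    by rewrite mul0n; apply: leq_trans (geq_minr _ _) _; apply: Bmin.
  by exists p, y.
Qed.

(** Covers through the apex give [s <= a 0 + A + A'], the others [s <= B + B']; these two bounds
    suffice to split the apex weight between the cycles. *)
Lemma two_cycle_duality n (a b : nat -> nat) s : 0 < n ->
    periodic (2 * n).+1 a -> periodic (2 * n).+1 b ->
    (forall c d, cycle_cover (2 * n).+1 c -> cycle_cover (2 * n).+1 d ->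
       c 0 = d 0 ->
       s <= c 0 * a 0 + \sum_(i < 2 * n) c i.+1 * a i.+1 +
            \sum_(i < 2 * n) d i.+1 * b i.+1) ->
  exists j k p q y z, [/\ j + k <= a 0,
    cycle_packing (2 * n).+1 (set_apex (2 * n).+1 a j) p y,
    cycle_packing (2 * n).+1 (set_apex (2 * n).+1 b k) q z &
    s <= n.+1 * (p + q) + \sum_(i < (2 * n).+1) y i + \sum_(i < (2 * n).+1) z i].
Proof.
move=> n0 aP bP sP.
have [A [B [AB ABc ABp]]] := apex_duality n0 aP.
have [A' [B' [AB' ABc' ABp']]] := apex_duality n0 bP.
have st : s <= a 0 + A + A'.
  have [c [cC c0 <-]] := ABc true; have [d [dC d0 <-]] := ABc' true.
  by have := sP c d cC dC; rewrite c0 d0 mul1n; apply.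
have sf : s <= B + B'.
  have [c [cC c0 <-]] := ABc false; have [d [dC d0 <-]] := ABc' false.
  by have := sP c d cC dC; rewrite c0 d0 mul0n; apply.
(* A share above [B - A] would not raise [minn (j + A) B]; the second cycle gets the remainder. *)
pose j := minn (a 0) (B - A).
have [p [y [yP sy]]] := ABp j; have [q [z [zP sz]]] := ABp' (a 0 - j).
exists j, (a 0 - j), p, q, y, z; split=> //; first by rewrite /j; lia.
by rewrite /j in sy sz *; lia.
Qed.

Local Open Scope classical_set_scope.
Local Open Scope ring_scope.

(** * Ideals and symbolic powers *)

Section IdealTheory.
Variable A : comNzRingType.
Implicit Types (I J P S : set A).

Lemma idealMl J a f : is_ideal J -> J f -> J (a * f).
Proof. by move=> [J0 Jl] Jf; rewrite -[_ * _]addr0; apply: Jl. Qed.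

Lemma ideal_sum J (T : Type) (r : seq T) (Q : pred T) (F : T -> A) :
  is_ideal J -> (forall i, Q i -> J (F i)) -> J (\sum_(i <- r | Q i) F i).
Proof.
move=> [J0 Jl] JF; apply: (big_ind J) => // f g Jf Jg.
by rewrite -[f]mul1r; apply: Jl.
Qed.

Lemma ideal_gen_min S J : is_ideal J -> S `<=` J -> ideal_gen S `<=` J.
Proof.
move=> JI SJ f [m [b [g [bg ->]]]]; apply: ideal_sum => // i _.
by apply: idealMl => //; apply: SJ; case: (bg i).
Qed.

Lemma sub_ideal_gen S : S `<=` ideal_gen S.
Proof.
move=> f Sf; exists 1%N, (fun=> 1), (fun=> f); split=> //.
by rewrite big_ord1 mul1r.
Qed.

Lemma ideal_gen_ideal S : is_ideal (ideal_gen S).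
Proof.
split; first by exists 0%N, (fun=> 0), (fun=> 0); rewrite big_ord0; split=> // -[].
move=> a _ _ [m [b [f [bf ->]]]] [k [d [g [dg ->]]]].
exists (m + k)%N.
exists (fun i => match split i with inl j => a * b j | inr j => d j end).
exists (fun i => match split i with inl j => f j | inr j => g j end); split.
  by move=> i; case: (split i) => j; split=> //; [case: (bf j)|case: (dg j)].
rewrite big_split_ord /= mulr_sumr; congr (_ + _); apply: eq_bigr => i _.
  by rewrite (unsplitK (inl i)) mulrA.
by rewrite (unsplitK (inr i)).
Qed.

Lemma principalP (c f : A) : principal c f <-> exists h, f = h * c.
Proof.
split=> [|[h ->]]; last first.
  by apply: idealMl; [exact: ideal_gen_ideal | exact: sub_ideal_gen].
move: f; apply: ideal_gen_min => [|_ ->]; last by exists 1; rewrite mul1r.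
split; first by exists 0; rewrite mul0r.
by move=> a _ _ [h ->] [k ->]; exists (a * h + k); ring.
Qed.

Lemma idealX_ideal I m : is_ideal (idealX I m).
Proof. by case: m => [|m]; [split | exact: ideal_gen_ideal]. Qed.

Lemma is_ideal_colon J g : is_ideal J -> is_ideal [set f | J (f * g)].
Proof.
move=> JI; split; first by rewrite /= mul0r; case: JI.
move=> a f h /= Jf Jh; rewrite mulrDl -mulrA; case: JI => _; exact.
Qed.

Lemma idealM_mem I J f g : I f -> J g -> idealM I J (f * g).
Proof. by move=> If Jg; apply: sub_ideal_gen; exists f => //; exists g. Qed.

Lemma idealM_min I I' J : is_ideal J ->
  (forall f g, I f -> I' g -> J (f * g)) -> idealM I I' `<=` J.
Proof.
by move=> JI sub; apply: ideal_gen_min => // _ [f If [g Jg <-]]; apply: sub.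
Qed.

Lemma idealXD I k l f g :
  idealX I k f -> idealX I l g -> idealX I (k + l) (f * g).
Proof.
elim: k f => [|k IHk] f; first by move=> _; apply: idealMl; exact: idealX_ideal.
move=> If Ig; move: f If.
apply: (@idealM_min _ _ [set f | idealX I (k.+1 + l) (f * g)]).
  by apply: is_ideal_colon; exact: idealX_ideal.
move=> f h If Ih /=.
by rewrite -mulrA; apply: idealM_mem => //; apply: IHk.
Qed.

Lemma idealX1 I f : I f -> idealX I 1 f.
Proof. by move=> If; rewrite -[f]mulr1; apply: idealM_mem. Qed.

Lemma idealX_exp I k f : I f -> idealX I k (f ^+ k).
Proof.
move=> If; elim: k => [|k IHk] //.
by rewrite exprS -[k.+1]add1n; apply: idealXD => //; apply: idealX1.
Qed.

Lemma idealX_anti I k l f : (k <= l)%N -> idealX I l f -> idealX I k f.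
Proof.
move=> /subnK <-; elim: (l - k)%N f => [|j IHj] // f.
rewrite addSn; move: f; apply: idealM_min; first exact: idealX_ideal.
by move=> f g _ Ig; apply: idealMl; [exact: idealX_ideal | exact: IHj].
Qed.

Lemma idealX_exponent I k l f : idealX I k f -> idealX I (k * l) (f ^+ l).
Proof.
move=> If; elim: l => [|l IHl]; first by rewrite muln0.
by rewrite exprS mulnS; apply: idealXD.
Qed.

Lemma idealX_principal (c : A) p f :
  idealX (principal c) p f -> exists h, f = h * c ^+ p.
Proof.
elim: p f => [|p IHp] f /=; first by exists f; rewrite expr0 mulr1.
move=> cf; apply/principalP; move: f cf; apply: idealM_min.
  exact: ideal_gen_ideal.
move=> f g /principalP[h ->] /IHp[k ->]; apply/principalP.
by exists (h * k); rewrite exprS; ring.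
Qed.

Lemma idealD_ideal I J : is_ideal I -> is_ideal J -> is_ideal (idealD I J).
Proof.
move=> [I0 Il] [J0 Jl]; split; first by exists 0 => //; exists 0; rewrite ?addr0.
move=> a _ _ [f If [g Jg <-]] [f' If' [g' Jg' <-]].
exists (a * f + f'); first exact: Il.
by exists (a * g + g'); [exact: Jl | ring].
Qed.

Lemma idealD_min I I' J : is_ideal J -> I `<=` J -> I' `<=` J ->
  idealD I I' `<=` J.
Proof.
move=> [J0 Jl] IJ I'J _ [f /IJ Jf [g /I'J Jg <-]].
by rewrite -[f]mul1r; apply: Jl.
Qed.

Lemma idealDl I J f : J 0 -> I f -> idealD I J f.
Proof. by move=> J0 If; exists f => //; exists 0; rewrite ?addr0. Qed.

Lemma idealDr I J f : I 0 -> J f -> idealD I J f.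
Proof. by move=> I0 Jf; exists 0 => //; exists f; rewrite ?add0r. Qed.

Section BigIdealD.
Variables (T : eqType) (r : seq T) (Q : pred T) (F : T -> set A).

Lemma big_idealD_min J : is_ideal J -> (forall i, Q i -> F i `<=` J) ->
  \big[@idealD A/[set 0]]_(i <- r | Q i) F i `<=` J.
Proof.
move=> JI FJ; apply: (big_ind (fun I => I `<=` J)) => //.
  by move=> _ ->; case: JI.
by move=> I I'; apply: idealD_min.
Qed.

Hypothesis F_ideal : forall i, Q i -> is_ideal (F i).

Lemma big_idealD_ideal : is_ideal (\big[@idealD A/[set 0]]_(i <- r | Q i) F i).
Proof.
apply: (big_ind (@is_ideal A)) => //; last exact: idealD_ideal.
by split=> // a _ _ -> ->; rewrite mulr0 addr0.
Qed.

End BigIdealD.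

Lemma big_idealD_mem (T : eqType) (r : seq T) (Q : pred T) (F : T -> set A) i f :
  (forall i, Q i -> is_ideal (F i)) -> i \in r -> Q i -> F i f ->
  (\big[@idealD A/[set 0]]_(i <- r | Q i) F i) f.
Proof.
move=> FI + Qi Ff; elim: r => // j r IHr; rewrite inE big_cons.
case/predU1P => [<-|/IHr{}IHr].
  by rewrite Qi; apply: idealDl => //; case: (big_idealD_ideal r FI).
by case: ifP => // Qj; apply: idealDr => //; case: (FI _ Qj).
Qed.

End IdealTheory.

(** * Symbolic powers without fractions *)

Section Contraction.
Variable A : idomainType.
Implicit Types (I J P : set A).

Lemma prime_idealN P f g : is_prime_ideal P -> ~ P f -> ~ P g -> ~ P (f * g).
Proof. by move=> [_ _ Pp] Pf Pg /Pp[]. Qed.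

(** A finite combination of fractions has a common denominator, outside [P] because [P] is prime;
    clearing it removes the fraction field from the description. *)
Lemma loc_contractionP P J (f : A) : is_prime_ideal P -> is_ideal J ->
  loc_contraction P J f <-> exists2 g, ~ P g & J (g * f).
Proof.
move=> Pp JI; have P_neq0 g : ~ P g -> tofrac g != 0.
  by move=> Pg; rewrite tofrac_eq0; apply: contra_notN Pg => /eqP ->; case: Pp => -[].
split=> [|[g Pg Jgf]]; last first.
  exists 1%N, (fun=> (tofrac g)^-1), (fun=> tofrac (g * f)); split.
    move=> _; split; last by exists (g * f).
    by exists 1, g; split=> //; rewrite rmorph1 mul1r.
  by rewrite big_ord1 rmorphM mulrA mulVf ?mul1r ?P_neq0.
move=> [m [b [g [bg fE]]]].
suff: exists2 d, ~ P d & exists2 h, J h &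
    tofrac d * \sum_(i < m) b i * g i = tofrac h.
  move=> [d Pd [h Jh]]; rewrite -fE -rmorphM => /eqP; rewrite tofrac_eq => /eqP dh.
  by exists d; rewrite // dh.
elim: m b g bg {fE} => [|m IHm] b g bg.
  exists 1; first by case: Pp.
  by exists 0; [case: JI | rewrite big_ord0 mulr0 rmorph0].
have [|d Pd [h Jh dh]] := IHm (fun i => b (lift ord0 i)) (fun i => g (lift ord0 i)).
  by move=> i; apply: bg.
rewrite big_ord_recl /=; case: (bg ord0) => -[u [v [Pv ->]]] [w Jw <-].
exists (v * d); first exact: prime_idealN.
exists (u * d * w + v * h).
  by case: (JI) => _; apply; [| apply: idealMl].
rewrite mulrDr rmorphM -[X in _ + X]mulrA dh rmorphD !rmorphM.
congr (_ + _); have := P_neq0 _ Pv => v0.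
by field.
Qed.

Lemma symbolic_powerE I s (f : A) : symbolic_power I s f <->
  forall P, associated_prime I P -> exists2 g, ~ P g & idealX I s (g * f).
Proof.
split=> [sf P IP|sf P /= IP].
  apply/(loc_contractionP _ _ (idealX_ideal I s)); first by case: IP.
  exact: sf.
apply/(loc_contractionP _ _ (idealX_ideal I s)); first by case: IP.
exact: sf.
Qed.

Lemma symbolic_power_ideal I s : is_ideal (symbolic_power I s).
Proof.
split.
  apply/symbolic_powerE => P [[_ P1 _] _]; exists 1 => //.
  by rewrite mulr0; case: (idealX_ideal I s).
move=> a f g /symbolic_powerE sf /symbolic_powerE sg.
apply/symbolic_powerE => P IP.
have [u Pu uf] := sf P IP; have [v Pv vg] := sg P IP.
exists (u * v); first by apply: prime_idealN => //; case: IP.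
have -> : u * v * (a * f + g) = v * a * (u * f) + u * (v * g) by ring.
by case: (idealX_ideal I s) => _; apply; [|apply: idealMl => //; exact: idealX_ideal].
Qed.

End Contraction.

(** * Monomial ideals and vertex covers *)

Section MonomialIdeals.
Variables (N : nat) (K : fieldType).
Implicit Types (f g : {mpoly K[N]}) (m k : 'X_{1..N}) (J : set {mpoly K[N]}).

Lemma mpoly_mem J f : is_ideal J ->
  (forall m, m \in msupp f -> J 'X_[m]) -> J f.
Proof.
move=> JI Jm; rewrite [f]mpolyE big_seq; apply: ideal_sum => // m /Jm Jm'.
by rewrite -mul_mpolyC; apply: idealMl.
Qed.

Lemma lem_mem J m k : is_ideal J -> (k <= m)%MM -> J 'X_[k] -> J 'X_[m].
Proof. by move=> JI /submK <- Jk; rewrite mpolyXD; apply: idealMl. Qed.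

Definition monomial_ideal (Q : pred 'X_{1..N}) : set {mpoly K[N]} :=
  [set f | forall m, m \in msupp f -> Q m].

Lemma monomial_idealX Q m : monomial_ideal Q 'X_[m] <-> Q m.
Proof.
split=> [->//|Qm k]; first by rewrite msuppX mem_seq1.
by rewrite msuppX mem_seq1 => /eqP ->.
Qed.

Lemma monomial_ideal_ideal (Q : pred 'X_{1..N}) :
  (forall k m, Q m -> Q (k + m)%MM) -> is_ideal (monomial_ideal Q).
Proof.
move=> QD; split=> [m|a f g Qf Qg m]; first by rewrite msupp0.
move=> /msuppD_le; rewrite mem_cat => /orP[|/Qg//].
by move=> /msuppM_le /allpairsP[[k l] /= [_ /Qf Ql ->]]; apply: QD.
Qed.

Definition mrestrict (q : pred 'X_{1..N}) f : {mpoly K[N]} :=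
  \sum_(m <- msupp f | q m) f@_m *: 'X_[m].

Lemma mcoeff_mrestrict q f m : (mrestrict q f)@_m = if q m then f@_m else 0.
Proof.
rewrite /mrestrict raddf_sum /=.
under eq_bigr do rewrite mcoeffZ mcoeffX.
have [mf|mf] := boolP (m \in msupp f); last first.
  rewrite (memN_msupp_eq0 mf) if_same big_seq_cond big1 // => k /andP[kf _].
  case: eqP => [km|_]; last by rewrite mulr0.
  by rewrite -km kf in mf.
rewrite big_mkcond (bigD1_seq m) //= eqxx mulr1 big1 ?addr0 // => k /negPf ->.
by rewrite mulr0 if_same.
Qed.

(** Lowest forms: the part of [g] with [d = 0] and the part of [f] outside [Q] of least [d] have a
    nonzero product, since polynomials form a domain, and its monomials survive in [g * f]. This
    yields both the primality of [cover_prime] and the primary property of [cover_power]. *)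
Lemma monomial_ideal_primary (Q : pred 'X_{1..N}) (d : 'X_{1..N} -> nat) f g :
  (forall m k, d (m + k)%MM = (d m + d k)%N) ->
  (forall k m, Q m -> Q (k + m)%MM) ->
  (forall k m, d k = 0%N -> Q (k + m)%MM -> Q m) ->
  ~ monomial_ideal [pred m | 0 < d m]%N g ->
  monomial_ideal Q (g * f) -> monomial_ideal Q f.
Proof.
move=> dD Qup Qd0 gN Qgf m0 m0f; apply: contrapT => /negP Qm0.
have [e [[m1 [m1f Qm1 m1e]] emin]] := @ex_least
  (fun e => exists m, [/\ m \in msupp f, ~~ Q m & d m = e])
  (ex_intro _ _ (ex_intro _ m0 (And3 m0f Qm0 erefl))).
have [k0 k0g dk0] : exists2 k, k \in msupp g & d k = 0%N.
  apply: contrapT => kN; apply: gN => k kg /=; rewrite lt0n.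
  by apply/negP => /eqP dk; apply: kN; exists k.
pose g0 := mrestrict (fun k => d k == 0%N) g.
pose f0 := mrestrict (fun k => ~~ Q k && (d k == e)) f.
have g0N0 : g0 != 0.
  apply/eqP => /(congr1 (mcoeff k0)); rewrite mcoeff_mrestrict dk0 mcoeff0 => /eqP.
  by rewrite mcoeff_eq0 k0g.
have f0N0 : f0 != 0.
  apply/eqP => /(congr1 (mcoeff m1)).
  by rewrite mcoeff_mrestrict Qm1 m1e eqxx mcoeff0 => /eqP; rewrite mcoeff_eq0 m1f.
have [m mgf] : exists m, m \in msupp (g0 * f0).
  have : g0 * f0 != 0 by rewrite mulf_neq0.
  by rewrite -msupp_eq0; case: (msupp _) => // m s _; exists m; rewrite inE eqxx.
have suppE q h k : k \in msupp (mrestrict q h) -> q k.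
  by rewrite -[_ \in _]negbK -mcoeff_eq0 mcoeff_mrestrict; case: (q k); rewrite ?eqxx.
have [dm Qm] : d m = e /\ ~~ Q m.
  have /msuppM_le/allpairsP[[k l] /= [/suppE/eqP dk /suppE/andP[Ql /eqP dl] ->]] := mgf.
  by rewrite dD dk dl; split=> //; apply: contraNN Ql; apply: Qd0.
(* A decomposition [m = k + l] with [l] in the support of [f] has [l] outside [Q], so [e <= d l]; as
   [d k + d l = e], only the lowest parts contribute. *)
suff gfE : (g * f)@_m = (g0 * f0)@_m.
  by move/negP: Qm; apply; apply: Qgf; rewrite mcoeff_msupp gfE -mcoeff_msupp.
rewrite !mcoeffM; apply: eq_bigr => -[k l] /= /eqP mE.
rewrite !mcoeff_mrestrict.
have Ql : ~~ Q l by apply: contraNN Qm => Ql; have := Qup k l Ql; rewrite -mE.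
have [lf|lf] := boolP ((l : 'X_{1..N}) \in msupp f); last first.
  by rewrite [f@_l]memN_msupp_eq0 // if_same !mulr0.
have el : (e <= d l)%N by apply: emin; exists l.
have dkl : (d k + d l)%N = e by rewrite -dD -mE.
have [-> ->] : d k = 0%N /\ d l = e by lia.
by rewrite Ql !eqxx.
Qed.

End MonomialIdeals.

(** * The edge ideal and its associated primes *)

Section EdgeIdeals.
Variables (K : fieldType) (V : finType) (D : weighted_oriented_graph V).
Hypothesis Vplus_sink : forall v, v \in Vplus D -> sink D v.
Implicit Types (u v : V) (C : {set V}) (m k : 'X_{1..#|V|}).
Local Notation I := (edge_ideal K D).
Local Notation w := (weight D).
Local Notation arc := Defs.arc.

(* Since the vertices of weight > 1 are sinks, the generator of an arc (u, v)
   is ['X_[phi u + phi v]], symmetric in u and v. *)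
Definition phi v : 'X_{1..#|V|} := (U_(enum_rank v) *+ w v)%MM.

(** How many factors [v ^ w v] the monomial contains; because of the rounding, heights are only
    superadditive. *)
Definition ht m v : nat := m (enum_rank v) %/ w v.

Lemma mnm_rankP m k :
  (forall v, m (enum_rank v) <= k (enum_rank v))%N -> (m <= k)%MM.
Proof. by move=> mk; apply/mnm_lepP => i; rewrite -(enum_valK i). Qed.

Lemma phiE v u : phi v (enum_rank u) = ((v == u) * w v)%N.
Proof. by rewrite /phi mulmnE mnm1E (inj_eq enum_rank_inj). Qed.

Lemma arc_weight1 u v : arc D u v -> w u = 1%N.
Proof.
move=> uv; apply/eqP; apply: contraTT uv => wu.
by have := Vplus_sink (v := u); apply.
Qed.

Lemma arc_generator u v : arc D u v ->
  var K u * var K v ^+ w v = 'X_[phi u + phi v].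
Proof.
by move=> uv; rewrite mpolyXD /phi -!mpolyXn (arc_weight1 uv) expr1.
Qed.

Lemma edge_mem u v : adj D u v -> I 'X_[phi u + phi v].
Proof.
case/orP => uv.
  by rewrite -arc_generator //; apply: sub_ideal_gen; exists u, v.
by rewrite addmC -arc_generator //; apply: sub_ideal_gen; exists v, u.
Qed.

Lemma edge_ideal_min J : is_ideal J ->
  (forall u v, arc D u v -> J 'X_[phi u + phi v]) -> I `<=` J.
Proof.
move=> JI sub; apply: ideal_gen_min => // _ [u [v [uv ->]]].
by rewrite arc_generator //; apply: sub.
Qed.

Definition vertex_cover C :=
  [forall u, forall v, arc D u v ==> (u \in C) || (v \in C)].

Lemma vertex_coverP C : reflect (forall u v, adj D u v -> (u \in C) || (v \in C))
  (vertex_cover C).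
Proof.
apply: (iffP forallP) => [cC u v|cC u]; last first.
  by apply/forallP => v; apply/implyP => uv; apply: cC; rewrite /adj uv.
case/orP => uv; first by have /forallP/(_ v)/implyP := cC u; apply.
by rewrite orbC; have /forallP/(_ u)/implyP := cC v; apply.
Qed.

Definition cover_degree C m := (\sum_(v in C) m (enum_rank v))%N.
Definition cover_height C m := (\sum_(v in C) ht m v)%N.

(* The prime generated by the variables of C, and the s-th power of the ideal
   generated by the v ^ w(v), for v in C. *)
Definition cover_prime C := @monomial_ideal _ K [pred m | 0 < cover_degree C m]%N.
Definition cover_power C s := @monomial_ideal _ K [pred m | s <= cover_height C m]%N.

Lemma cover_degreeD C m k :
  cover_degree C (m + k)%MM = (cover_degree C m + cover_degree C k)%N.
Proof. by rewrite -big_split; apply: eq_bigr => v _; rewrite mnmDE. Qed.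

Lemma cover_heightD C m k :
  (cover_height C m + cover_height C k <= cover_height C (m + k)%MM)%N.
Proof.
rewrite -big_split; apply: leq_sum => v _; rewrite /ht mnmDE.
by rewrite divnD ?weight_gt0 ?leq_addr.
Qed.

Lemma cover_prime_ideal C : is_ideal (cover_prime C).
Proof.
by apply: monomial_ideal_ideal => k m /=; rewrite cover_degreeD; lia.
Qed.

Lemma cover_power_ideal C s : is_ideal (cover_power C s).
Proof.
apply: monomial_ideal_ideal => k m /= sm.
exact: leq_trans (leq_trans sm (leq_addl _ _)) (cover_heightD C k m).
Qed.

(** A monomial free of the variables of [C] leaves all heights on [C] unchanged, so
    [monomial_ideal_primary] applies with [d] the degree in [C]. *)
Lemma cover_power_primary C s f g : ~ cover_prime C g ->
  cover_power C s (g * f) -> cover_power C s f.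
Proof.
apply: monomial_ideal_primary => [||k m /eqP].
- exact: cover_degreeD.
- move=> k m /= sm.
  exact: leq_trans (leq_trans sm (leq_addl _ _)) (cover_heightD C k m).
- rewrite sum_nat_eq0 => /forallP k0 /= sm; apply: (leq_trans sm).
  apply: eq_leq; apply: eq_bigr => v vC.
  by rewrite /ht mnmDE; have /implyP/(_ vC)/eqP -> := k0 v.
Qed.

Lemma cover_prime_prime C : is_prime_ideal (cover_prime C).
Proof.
split; first exact: cover_prime_ideal.
  rewrite -mpolyX0 => /monomial_idealX /=; rewrite /cover_degree big1 //.
  by move=> v _; rewrite mnm0E.
move=> f g fg; have [|fN] := pselect (cover_prime C f); [by left | right].
(* Primality is the case where [Q] itself is positivity of the degree in [C]. *)
move: fN fg; apply: monomial_ideal_primary => [||k m /= dk].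
- exact: cover_degreeD.
- by move=> k m /=; rewrite cover_degreeD; lia.
- by rewrite cover_degreeD dk.
Qed.

Lemma edge_ideal_sub C : vertex_cover C -> I `<=` cover_power C 1.
Proof.
move=> /vertex_coverP cC; apply: edge_ideal_min; first exact: cover_power_ideal.
move=> u v uv; apply/monomial_idealX => /=.
apply: leq_trans (cover_heightD _ _ _).
have ht1 x : x \in C -> (0 < cover_height C (phi x))%N.
  move=> xC; rewrite /cover_height (bigD1 x) //= /ht phiE eqxx mul1n divnn.
  by rewrite weight_gt0.
have uv' : adj D u v by rewrite /adj uv.
case/orP: (cC u v uv') => /ht1 ht1x.
  exact: leq_trans ht1x (leq_addr _ _).
exact: leq_trans ht1x (leq_addl _ _).
Qed.

Lemma edge_idealX_sub C s : vertex_cover C -> idealX I s `<=` cover_power C s.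
Proof.
move=> cC; elim: s => [|s IHs]; first by [].
apply: idealM_min; first exact: cover_power_ideal.
move=> f g /(edge_ideal_sub cC) fC /IHs gC m.
move=> /msuppM_le/allpairsP[[k l] /= [/fC /= kC /gC /= lC ->]].
exact: leq_trans (leq_add kC lC) (cover_heightD C k l).
Qed.

(** Otherwise removing [v] would leave a smaller cover. *)
Lemma minimal_cover_neighbor C v : minset vertex_cover C -> v \in C ->
  exists2 u, u \notin C & adj D u v.
Proof.
move=> /minsetP[/vertex_coverP cC Cmin] vC; apply: contrapT => uN.
have : C :\ v = C.
  apply: Cmin; last exact: subD1set.
  apply/vertex_coverP => x y xy; rewrite !inE.
  have := cC _ _ xy.
  have [xv|xv] := eqVneq x v; have [yv|yv] := eqVneq y v => //=.
  - move: xy; rewrite xv yv /adj; case/orP => vv; by have := arc_asym vv; rewrite vv.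
  - move=> _; apply: contrapT => /negP yC; apply: uN; exists y => //.
    by rewrite -xv /adj orbC.
  - by move=> _; apply: contrapT; rewrite orbF => /negP xC; apply: uN; exists x; rewrite -?yv.
by move=> /setP/(_ v); rewrite !inE eqxx vC.
Qed.

Lemma cover_prime_associated C :
  minset vertex_cover C -> associated_prime I (cover_prime C).
Proof.
move=> Cm; have /minsetP[cC _] := Cm.
split; first exact: cover_prime_prime.
(* The witness has full exponent [w v] off [C] and one less on [C]: its heights on [C] vanish, yet
   one more factor [v] in [C] completes a generator with a neighbour of [v] outside [C]. *)
pose mw : 'X_{1..#|V|} := [multinom
  (if enum_val i \in C then (w (enum_val i)).-1 else w (enum_val i)) | i < #|V|].
have mwE v : mw (enum_rank v) = if v \in C then (w v).-1 else w v.
  by rewrite mnmE enum_rankK.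
exists 'X_[mw]; apply/seteqP; split=> g /=.
  move=> gC; suff : [set g | I (g * 'X_[mw])] g by [].
  apply: mpoly_mem; first by apply: is_ideal_colon; exact: ideal_gen_ideal.
  move=> m /gC /=; rewrite lt0n sum_nat_eq0 => /forallPn[v].
  rewrite negb_imply => /andP[vC mv].
  have [u uC uv] := minimal_cover_neighbor Cm vC.
  rewrite -mpolyXD; apply: lem_mem (edge_mem uv); first exact: ideal_gen_ideal.
  apply: mnm_rankP => x; rewrite !mnmDE !phiE mwE.
  have := weight_gt0 D v.
  have [xu|] := eqVneq u x; have [xv|] := eqVneq v x => //=.
  - by move: uC; rewrite xu -xv vC.
  - by rewrite -xu (negPf uC) => ? ?; lia.
  - rewrite -xv vC mul0n mul1n add0n => _ wv.
    by rewrite -[X in (X <= _)%N](prednK wv) -add1n leq_add2r lt0n.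
move=> /(edge_ideal_sub cC) gC; apply: contrapT => gN.
move: (cover_power_primary gN gC) => /monomial_idealX /=.
rewrite /cover_height big1 // => v vC; rewrite /ht mwE vC divn_small //.
by rewrite prednK // weight_gt0.
Qed.

(** An inclusion serves the purpose: multipliers outside [cover_prime C] are then outside [P]. *)
Lemma associated_prime_sub P : associated_prime I P ->
  exists2 C, minset vertex_cover C & P `<=` cover_prime C.
Proof.
move=> [[_ P1 _] [f PE]].
have fI : ~ I f by move=> If; apply: P1; rewrite PE /= mul1r.
have [m mf mI] : exists2 m, m \in msupp f & ~ I 'X_[m].
  apply: contrapT => mN; apply: fI; apply: mpoly_mem.
    exact: ideal_gen_ideal.
  by move=> m mf; apply: contrapT => mI; apply: mN; exists m.
(* A monomial outside the ideal has no edge with both heights positive, so its vertices of height 0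
   form a cover. On a minimal cover inside it [m] has height 0, so no multiplier outside
   [cover_prime C] can take [f] into the ideal. *)
pose C0 := [set v | ht m v == 0%N]%SET.
have cC0 : vertex_cover C0.
  apply/vertex_coverP => u v uv; rewrite !inE; apply: contrapT => /negP.
  rewrite negb_or -!lt0n /ht !divn_gt0 ?weight_gt0 // => /andP[um vm].
  apply: mI; apply: lem_mem (edge_mem uv); first exact: ideal_gen_ideal.
  apply: mnm_rankP => x; rewrite !mnmDE !phiE.
  have [xu|_] := eqVneq u x; have [xv|_] := eqVneq v x => //=.
  - by move: uv; rewrite xu xv /adj orbb => vv; have := arc_asym vv; rewrite vv.
  - by rewrite mul1n mul0n addn0 -xu.
  - by rewrite mul1n mul0n add0n -xv.
have [C Cm CC0] := minset_exists cC0.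
have /minsetP[cC _] := Cm.
exists C => // g; rewrite PE /= => /(edge_ideal_sub cC) gfC.
apply: contrapT => gN; have /(_ m mf) /= := cover_power_primary gN gfC.
rewrite /cover_height big1 // => v /(fintype.subsetP CC0); by rewrite inE => /eqP.
Qed.

Lemma symbolic_power_sub C s :
  vertex_cover C -> symbolic_power I s `<=` cover_power C s.
Proof.
(* A minimal cover inside [C] gives an associated prime and already forces height [s]; the other
   vertices of [C] only add to it. *)
move=> cC0 f /symbolic_powerE sf; have [C' Cm CC'] := minset_exists cC0.
have /minsetP[cC _] := Cm.
have [g gN /(edge_idealX_sub cC) gf] := sf _ (cover_prime_associated Cm).
move=> m /(cover_power_primary gN gf) /= /leq_trans; apply.
by rewrite /cover_height [X in (_ <= X)%N](finset.big_setID C') /=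
  (finset.setIidPr CC') leq_addr.
Qed.

End EdgeIdeals.

(** * Monomials along an odd cycle *)

Section Cycles.
Variables (K : fieldType) (V : finType) (D : weighted_oriented_graph V).
Hypothesis Vplus_sink : forall v, v \in Vplus D -> sink D v.
Implicit Types (u v : V) (C : {set V}) (m e : 'X_{1..#|V|}).
Local Notation I := (edge_ideal K D).
Local Notation w := (weight D).
Local Notation phi := (phi D).

(* A monomial of I^k together with the degree bound inherited from the edges. *)
Definition edge_power k m := idealX I k 'X_[m] /\ (k.*2 <= mdeg m)%N.

Lemma edge_power0 m : edge_power 0 m.
Proof. by []. Qed.

Lemma edge_powerD k l m e :
  edge_power k m -> edge_power l e -> edge_power (k + l) (m + e)%MM.
Proof.
move=> [mI km] [eI le]; split; first by rewrite mpolyXD; apply: idealXD.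
by rewrite mdegD doubleD leq_add.
Qed.

Lemma edge_power_anti k l m : (k <= l)%N -> edge_power l m -> edge_power k m.
Proof.
move=> kl [mI lm]; split; first exact: idealX_anti mI.
by apply: leq_trans lm; rewrite leq_double.
Qed.

Lemma mdeg_phi v : mdeg (phi v) = w v.
Proof. by rewrite mdegMn mdeg1 mul1n. Qed.

Lemma edge_power_adj u v : adj D u v -> edge_power 1 (phi u + phi v)%MM.
Proof.
move=> uv; split; first by apply: idealX1; apply: edge_mem.
by rewrite mdegD !mdeg_phi (leq_add (weight_gt0 D u) (weight_gt0 D v)).
Qed.

Lemma edge_power_muln k m : edge_power 1 m -> edge_power k (m *+ k)%MM.
Proof.
move=> m1; elim: k => [|k IHk]; first exact: edge_power0.
by rewrite mulmS -add1n; apply: edge_powerD.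
Qed.

Section Cycle.
Variables (n : nat) (z : 'I_(2 * n).+1 -> V).
Hypothesis z_inj : injective z.
Hypothesis z_adj : forall i, adj D (z i) (z (ordS i)).
Local Notation M := (2 * n).+1.

(** Indices run through all naturals modulo [M], matching the periodic sequences of the packing
    lemmas. *)
Definition cyc i := z (inord (i %% M)).

Lemma cyc_periodic : periodic M cyc.
Proof. by move=> i; rewrite /cyc modnDr. Qed.

Lemma cyc_ord (i : 'I_M) : cyc i = z i.
Proof. by rewrite /cyc modn_small // inord_val. Qed.

Lemma cyc_adj i : adj D (cyc i) (cyc i.+1).
Proof.
have -> : cyc i.+1 = z (ordS (inord (i %% M))).
  congr z; apply/val_inj; rewrite /= !inordK ?ltn_pmod //.
  by rewrite -addn1 -[in RHS]addn1 modnDml.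
exact: z_adj.
Qed.

Definition cycle_exponent := (\sum_(i < M) phi (cyc i))%MM.

Lemma cycle_monomialE : cycle_monomial K D z = 'X_[cycle_exponent].
Proof.
transitivity (\prod_(v in codom z) 'X_[phi v] : {mpoly K[#|V|]}).
  rewrite [RHS](bigID (mem (Vplus D))) /= mulrC; congr (_ * _).
    apply: eq_bigr => v /andP[_]; rewrite negbK => /eqP wv.
    by rewrite /phi wv mulm1n.
  by apply: eq_bigr => v _; rewrite /phi -mpolyXn.
rewrite /cycle_exponent -mprodXE.
rewrite [RHS](eq_bigr (fun i => 'X_[phi (z i)])); last by move=> i _; rewrite cyc_ord.
by rewrite -big_uniq ?map_inj_uniq -?enumT ?enum_uniq //= big_map big_enum.
Qed.

Lemma edge_power_walk j k : edge_power k (\sum_(i < 2 * k) phi (cyc (i + j)))%MM.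
Proof.
elim: k => [|k IHk]; first exact: edge_power0.
have -> : (2 * k.+1 = (2 * k).+2)%N by lia.
rewrite !big_ord_recr /= -addmA -addn1; apply: edge_powerD => //.
exact: edge_power_adj (cyc_adj _).
Qed.

(** The first [2 * n] vertices pair up into [n] edges; the last one is a spare factor. *)
Lemma edge_power_cycle : edge_power n cycle_exponent.
Proof.
rewrite /cycle_exponent big_ord_recr /= -[n in edge_power n]addn0.
apply: edge_powerD; last exact: edge_power0.
have := edge_power_walk 0 n.
by rewrite (eq_bigr (fun i : 'I_(2 * n) => phi (cyc i))) // => i; rewrite addn0.
Qed.

(* Doubling a vertex of an odd cycle turns it into a walk with n + 1 disjoint
   edges. *)
Lemma edge_power_cycleS j : edge_power n.+1 (phi (cyc j) + cycle_exponent)%MM.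
Proof.
have := edge_power_walk j n.+1; have -> : (2 * n.+1 = M.+1)%N by lia.
rewrite big_ord_recr /= addmC addnC cyc_periodic.
rewrite (@big_periodic _ _ _ M (fun i => phi (cyc i))) // => i.
by rewrite cyc_periodic.
Qed.

Lemma mdeg_cycle_exponent : mdeg cycle_exponent = (\sum_(i < M) w (z i))%N.
Proof.
by rewrite mdeg_sum; apply: eq_bigr => i _; rewrite mdeg_phi cyc_ord.
Qed.

Lemma mdeg_cycle_exponent_eq : ~ (exists i, z i \in Vplus D) ->
  mdeg cycle_exponent = M.
Proof.
move=> zN; rewrite mdeg_cycle_exponent (eq_bigr (fun=> 1%N)).
  by rewrite sum1_card card_ord.
by move=> i _; apply/eqP; apply: contraT => wi; case: zN; exists i.
Qed.

Lemma mdeg_cycle_exponent_gt : (exists i, z i \in Vplus D) ->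
  (M < mdeg cycle_exponent)%N.
Proof.
case=> i wi; rewrite mdeg_cycle_exponent -[X in (X < _)%N]card_ord -sum1_card.
rewrite (bigD1 i) //= [X in (_ < X)%N](bigD1 i) //= -addSn leq_add //.
  by rewrite ltn_neqAle eq_sym weight_gt0 andbT.
by apply: leq_sum => j _; apply: weight_gt0.
Qed.

Lemma sum_phiE (a : nat -> nat) i :
  (\sum_(j < M) phi (cyc j) *+ a j)%MM (enum_rank (z i)) = (w (z i) * a i)%N.
Proof.
rewrite mnm_sumE (bigD1 i) //= mulmnE phiE cyc_ord eqxx mul1n big1 ?addn0 //.
by move=> j ji; rewrite mulmnE phiE cyc_ord (inj_eq z_inj) (negPf ji).
Qed.

Lemma sum_phi_notin (a : nat -> nat) v : v \notin codom z ->
  (\sum_(j < M) phi (cyc j) *+ a j)%MM (enum_rank v) = 0%N.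
Proof.
move=> vz; rewrite mnm_sumE big1 // => j _; rewrite mulmnE phiE cyc_ord.
by case: eqP => // zj; rewrite -zj codom_f in vz.
Qed.

(** Carries a numerical packing over to a divisibility of monomials, with [e] the product of the
    packed edges. *)
Lemma edge_power_packing (a : nat -> nat) p y :
  periodic M a -> cycle_packing M a p y ->
  exists2 e, edge_power (\sum_(i < M) y i) e &
    (e + cycle_exponent *+ p <= \sum_(i < M) phi (cyc i) *+ a i)%MM.
Proof.
move=> aP [yP py].
exists (\sum_(i < M) (phi (cyc i) + phi (cyc i.+1)) *+ y i)%MM.
  apply: (big_ind2 edge_power) => [||i _]; first exact: edge_power0.
    by move=> *; apply: edge_powerD.
  by apply: edge_power_muln; apply: edge_power_adj; apply: cyc_adj.
apply/mnm_lepP => t; pose F i := phi (cyc i) t.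
have FP : periodic M F by move=> i; rewrite /F cyc_periodic.
rewrite mnmDE mulmnE !mnm_sumE.
rewrite (eq_bigr (fun i : 'I_M => F i * y i + F i.+1 * y i)%N); last first.
  by move=> i _; rewrite mulmnE mnmDE mulnDl.
rewrite [X in (_ <= X)%N](eq_bigr (fun i : 'I_M => F i * a i)%N); last first.
  by move=> i _; rewrite mulmnE.
(* All sums are rotated to index [i.+1], where the packing condition compares them term by term. *)
have rot f : periodic M f -> (\sum_(i < M) f i = \sum_(i < M) f i.+1)%N.
  move=> fP; rewrite -(big_periodic _ 1 fP); apply: eq_bigr => i _.
  by rewrite addn1.
rewrite big_split /= (rot (fun i => F i * y i)%N); last by move=> i; rewrite FP yP.
rewrite (rot F) // [X in (_ <= X)%N](rot (fun i => F i * a i)%N); last first.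
  by move=> i; rewrite FP aP.
rewrite big_distrl -!big_split /=; apply: leq_sum => i _.
rewrite -!mulnDr leq_mul2l; apply/orP; right; have := py i; lia.
Qed.

End Cycle.
End Cycles.

(** * Two odd cycles with a common vertex *)

Section Symmetry.
Variables (V : finType) (D : weighted_oriented_graph V) (n : nat).
Implicit Types x y : 'I_(2 * n).+1 -> V.

Lemma clique_sum_sym x y :
  clique_sum_of_odd_cycles D x y -> clique_sum_of_odd_cycles D y x.
Proof.
case=> -[xI yI] xy cov E; split=> [//|i j|v|u v].
- by split=> [/esym/xy[-> ->]|[-> ->]] //; apply/esym/xy.
- by rewrite orbC.
- by rewrite E or_comm.
Qed.

(** A vertex other than the apex, such as the one of index 1, has all its neighbours on its own
    cycle; if that cycle lay in [C], minimality would still give it a neighbour outside [C]. *)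
Lemma minimal_cover_avoids x y C : (0 < n)%N ->
  clique_sum_of_odd_cycles D x y -> minset (vertex_cover D) C ->
  exists i, x i \notin C.
Proof.
move=> n_gt0 [_ xy _ E] Cm; apply: contrapT => xC.
have i1 : (inord 1 : 'I_(2 * n).+1) <> ord0.
  by move/(congr1 val) => /=; rewrite inordK //; lia.
have {}xC i : x i \in C by apply: contrapT => /negP xi; apply: xC; exists i.
have [u uC] := minimal_cover_neighbor Cm (xC (inord 1)).
case/E => -[i [[ui yi]|[yi ui]]].
- by rewrite ui xC in uC.
- by rewrite ui xC in uC.
- by have /xy[] := yi.
- by have /xy[] := yi.
Qed.

(* The elements of [Vplus D] are pairwise non adjacent, so along a cycle
   without an edge outside [Vplus D] they would alternate with the others. *)
Lemma exists_edge_notin_Vplus (z : 'I_(2 * n).+1 -> V) :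
  (forall v, v \in Vplus D -> sink D v) ->
  (forall i, adj D (z i) (z (ordS i))) ->
  exists u v, [/\ adj D u v, weight D u = 1%N & weight D v = 1%N].
Proof.
move=> Vplus_sink z_adj; pose P i := cyc z i \in Vplus D.
have z_adjN := cyc_adj z_adj.
have PN i : ~~ (P i && P i.+1).
  apply/negP => /andP[/Vplus_sink si /Vplus_sink sSi].
  by case/orP: (z_adjN i); apply/negP; [apply: si | apply: sSi].
apply: contrapT => noE.
have PS i : P i.+1 = ~~ P i.
  case: (boolP (P i)) (PN i) => [_ /= /negPf -> //|Pi _] /=.
  apply: contrapT => /negP PSi; apply: noE.
  by exists (cyc z i), (cyc z i.+1); split=> //; apply/eqP; rewrite -[_ == _]negbK.
have PE i : P i = odd i (+) P 0.
  by elim: i => [|i IHi] //=; rewrite PS IHi addNb.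
(* Position [2 * n + 1] is position 0 again, at odd distance. *)
have := PE (2 * n).+1; rewrite /P -[(2 * n).+1]add0n cyc_periodic /= mul2n odd_double.
by case: (_ \in _).
Qed.

End Symmetry.

Section CliqueSum.
Variables (K : fieldType) (V : finType) (D : weighted_oriented_graph V).
Variables (n : nat) (x y : 'I_(2 * n).+1 -> V).
Hypothesis n_gt0 : (0 < n)%N.
Hypothesis DG : clique_sum_of_odd_cycles D x y.
Hypothesis Vplus_sink : forall v, v \in Vplus D -> sink D v.
Implicit Types (u v : V) (C : {set V}) (m e : 'X_{1..#|V|}).
Local Notation I := (edge_ideal K D).
Local Notation w := (weight D).
Local Notation phi := (phi D).
Local Notation M := (2 * n).+1.
Local Notation mx := (cycle_exponent D x).
Local Notation my := (cycle_exponent D y).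

Let x_inj : injective x. Proof. by case: DG => -[]. Qed.
Let y_inj : injective y. Proof. by case: DG => -[]. Qed.
Let xy_common i j : x i = y j <-> i = ord0 /\ j = ord0.
Proof. by case: DG. Qed.
Let xy0 : x ord0 = y ord0. Proof. exact/xy_common. Qed.
Let x_adj i : adj D (x i) (x (ordS i)).
Proof. by case: DG => _ _ _ E; apply/E; left; exists i; left. Qed.
Let y_adj i : adj D (y i) (y (ordS i)).
Proof. by case: DG => _ _ _ E; apply/E; right; exists i; left. Qed.

(** The heights of [m] along the two cycles are the weights fed to [two_cycle_duality]; the
    resulting packings become monomials. *)
Lemma covers_decomposition s m :
  (forall C, vertex_cover D C -> (s <= cover_height D C m)%N) ->
  exists p q E e, [/\ edge_power K D E e, (s <= E + n.+1 * (p + q))%N &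
    (e + mx *+ p + my *+ q <= m)%MM].
Proof.
move=> sC; pose a i := ht D m (cyc x i); pose b i := ht D m (cyc y i).
have aP : periodic M a by move=> i; rewrite /a cyc_periodic.
have bP : periodic M b by move=> i; rewrite /b cyc_periodic.
have [c d [cP cE] [dP dE] cd0|j [k [p [q [f [g [jk fP gP sE]]]]]]] :=
  two_cycle_duality (s := s) n_gt0 aP bP.
  (* Two cycle covers that agree at the apex unite to a vertex cover, to which the hypothesis
     applies. *)
  pose C := [set v | [exists i : 'I_M, (x i == v) && c i] ||
                     [exists j : 'I_M, (y j == v) && d j]]%SET.
  have xC (i : 'I_M) : c i -> x i \in C.
    by move=> ci; rewrite inE; apply/orP; left; apply/existsP; exists i; rewrite eqxx.
  have yC (i : 'I_M) : d i -> y i \in C.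
    by move=> di; rewrite inE; apply/orP; right; apply/existsP; exists i; rewrite eqxx.
  have cS (i : 'I_M) : c i || c (ordS i).
    by have := cE i; rewrite [c i.+1](periodicE _ cP).
  have dS (i : 'I_M) : d i || d (ordS i).
    by have := dE i; rewrite [d i.+1](periodicE _ dP).
  apply: leq_trans (sC C _) _.
    apply/vertex_coverP => u v; case: DG => _ _ _ EE.
    case/EE => -[i [[-> ->]|[-> ->]]].
    - by case/orP: (cS i) => /xC ->; rewrite ?orbT.
    - by case/orP: (cS i) => /xC ->; rewrite ?orbT.
    - by case/orP: (dS i) => /yC ->; rewrite ?orbT.
    - by case/orP: (dS i) => /yC ->; rewrite ?orbT.
  (* The weights are redistributed over the vertices; the apex is charged to the first cycle alone,
     so that it counts once. *)
  pose X v := (\sum_(i < M) (x i == v) * (c i * a i))%N.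
  pose Y v := (\sum_(i < 2 * n) (cyc y i.+1 == v) * (d i.+1 * b i.+1))%N.
  have delta u t : (\sum_v (u == v) * t = t)%N.
    rewrite (bigD1 u) //= eqxx mul1n big1 ?addn0 // => v /negPf.
    by rewrite eq_sym => ->.
  have -> : (c 0%N * a 0%N + \sum_(i < 2 * n) c i.+1 * a i.+1 +
      \sum_(i < 2 * n) d i.+1 * b i.+1 = \sum_v (X v + Y v))%N.
    rewrite big_split /=; congr addn; rewrite exchange_big /=; last first.
      by apply: eq_bigr => i _; rewrite delta.
    by rewrite big_ord_recl delta; congr addn; apply: eq_bigr => i _; rewrite delta.
  rewrite /cover_height big_mkcond leq_sum // => v _; case: ifP => //.
  have Xv (i : 'I_M) : x i = v -> c i -> (ht D m v <= X v)%N.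
    by move=> xi ci; rewrite /X (bigD1 i) //= xi eqxx ci !mul1n /a cyc_ord xi leq_addr.
  rewrite inE => /orP[/existsP[i /andP[/eqP xi ci]]|/existsP[j /andP[/eqP yj dj]]].
    by apply: leq_trans (leq_addr _ _); apply: Xv ci.
  case: (unliftP ord0 j) => [i|] jE; last first.
    apply: leq_trans (leq_addr _ _); apply: (Xv ord0); first by rewrite -yj jE.
    by rewrite cd0; rewrite jE in dj.
  have yi : cyc y i.+1 = v by rewrite -yj -cyc_ord jE.
  apply: leq_trans (leq_addl _ _).
  rewrite /Y (bigD1 i) //= yi eqxx; rewrite jE in dj.
  by rewrite (dj : d i.+1) !mul1n /b yi leq_addr.
have apexP (t : nat -> nat) l : periodic M t -> periodic M (set_apex M t l).
  by move=> tP i; rewrite /set_apex modnDr tP.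
have [e eE em] := edge_power_packing K Vplus_sink x_adj (apexP _ _ aP) fP.
have [e' eE' em'] := edge_power_packing K Vplus_sink y_adj (apexP _ _ bP) gP.
exists p, q, (\sum_(i < M) f i + \sum_(i < M) g i)%N, (e + e')%MM; split.
- exact: edge_powerD.
- by rewrite addnC addnA.
apply: mnm_rankP => v.
have /mnm_lepP/(_ (enum_rank v)) := em; have /mnm_lepP/(_ (enum_rank v)) := em'.
rewrite !mnmDE.
suff : ((\sum_(i < M) phi (cyc x i) *+ set_apex M a j i)%MM (enum_rank v) +
  (\sum_(i < M) phi (cyc y i) *+ set_apex M b k i)%MM (enum_rank v)
    <= m (enum_rank v))%N.
  by move=> le ? ?; apply: leq_trans le; rewrite -addnA addnACA leq_add.
have htv t : (t <= ht D m v -> w v * t <= m (enum_rank v))%N.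
  by move=> tv; rewrite mulnC -leq_divRL ?weight_gt0.
have apex (t : nat -> nat) l (i : 'I_M) :
    set_apex M t l i = if i == ord0 then l else t i.
  by rewrite /set_apex modn_small.
(* Off the apex a vertex lies on one cycle only; at the apex the shares [j] and [k] fit because
   [j + k <= a 0]. *)
have [/codomP[i vE]|vx] := boolP (v \in codom x).
  rewrite {1}vE sum_phiE // -vE apex /a.
  case: eqP => i0; last first.
    rewrite sum_phi_notin ?addn0 ?htv ?cyc_ord ?vE //.
    by apply/codomP => -[l]; rewrite ?vE => /xy_common[].
  have vy : v = y ord0 by rewrite vE i0.
  rewrite {2}vy sum_phiE // -vy apex eqxx -mulnDr htv //.
  by apply: leq_trans jk _; rewrite /a vE i0 -cyc_ord.
rewrite sum_phi_notin // add0n.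
have [l vE] : exists l, v = y l.
  by case: DG => _ _ /(_ v) + _; rewrite (negPf vx) => /codomP.
rewrite {1}vE sum_phiE // -vE apex /b.
case: eqP => l0; last by rewrite htv // cyc_ord vE.
by rewrite vE l0 -xy0 codom_f in vx.
Qed.

(* The number of cycles is made at most s / (n + 1) by trading a cycle for n of
   its edges. *)
Lemma covers_decomposition_le s m :
  (forall C, vertex_cover D C -> (s <= cover_height D C m)%N) ->
  exists p q e, [/\ ((p + q) * (n + 1) <= s)%N,
    edge_power K D (s - (p + q) * (n + 1)) e &
    (e + mx *+ p + my *+ q <= m)%MM].
Proof.
move=> /covers_decomposition[p [q [E [e [+ + +]]]]].
have [t] := ubnP (p + q); elim: t => // t IHt in p q E e *.
move=> pqt eE sE em; have [le_s|gt_s] := leqP ((p + q) * (n + 1)) s.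
  by exists p, q, e; split=> //; apply: edge_power_anti eE; lia.
(* As [s < (p + q) * (n + 1)], one cycle fewer still accounts for [s - n], and the [n] edges of the
   dropped cycle make up the difference. *)
case: p q => [|p] [|q] in pqt sE em gt_s *; first by lia.
- apply: (IHt 0%N q (E + n)%N (e + my)%MM); [lia| |lia|].
    by apply: edge_powerD => //; apply: edge_power_cycle.
  by move: em; rewrite mulmS !addmA [(_ + my)%MM]addmC !addmA [(my + e)%MM]addmC.
- apply: (IHt p 0%N (E + n)%N (e + mx)%MM); [lia| |lia|].
    by apply: edge_powerD => //; apply: edge_power_cycle.
  by move: em; rewrite mulmS !addmA.
- apply: (IHt p q.+1 (E + n)%N (e + mx)%MM); [lia| |lia|].
    by apply: edge_powerD => //; apply: edge_power_cycle.
  by move: em; rewrite mulmS !addmA.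
Qed.

Lemma symbolic_power_mem s p q f : ((p + q) * (n + 1) <= s)%N ->
  idealX I (s - (p + q) * (n + 1)) f ->
  symbolic_power I s (f * 'X_[mx] ^+ p * 'X_[my] ^+ q).
Proof.
move=> le_s fI; apply/symbolic_powerE => P /(associated_prime_sub Vplus_sink)[C Cm PC].
have [i xi] := minimal_cover_avoids n_gt0 DG Cm.
have [j yj] := minimal_cover_avoids n_gt0 (clique_sum_sym DG) Cm.
(* Vertices of the two cycles outside [C] turn each cycle monomial into [n + 1] edges, and the
   product of their powers avoids [P]. *)
exists ('X_[phi (x i)] ^+ p * 'X_[phi (y j)] ^+ q).
  move/PC; rewrite !mpolyXn -mpolyXD => /monomial_idealX /=.
  rewrite /cover_degree big1 // => v vC;
  rewrite mnmDE (mulmnE (phi (x i))) (mulmnE (phi (y j))) !phiE.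
  case: eqP => [xv|_]; first by rewrite xv vC in xi.
  by case: eqP => [yv|_ //]; rewrite yv vC in yj.
have -> : 'X_[phi (x i)] ^+ p * 'X_[phi (y j)] ^+ q *
    (f * 'X_[mx] ^+ p * 'X_[my] ^+ q) =
    f * 'X_[(phi (x i) + mx)%MM] ^+ p * 'X_[(phi (y j) + my)%MM] ^+ q.
  by rewrite !mpolyXD !exprMn; ring.
have -> : s = (s - (p + q) * (n + 1) + n.+1 * p + n.+1 * q)%N by nia.
apply: idealXD; first (apply: idealXD => //); apply: idealX_exponent.
  by have [] := edge_power_cycleS K Vplus_sink x_adj i; rewrite cyc_ord.
by have [] := edge_power_cycleS K Vplus_sink y_adj j; rewrite cyc_ord.
Qed.

Lemma symbolic_power_supp s f m : symbolic_power I s f -> m \in msupp f ->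
  exists p q e, [/\ ((p + q) * (n + 1) <= s)%N,
    edge_power K D (s - (p + q) * (n + 1)) e &
    (e + mx *+ p + my *+ q <= m)%MM].
Proof.
move=> sf mf; apply: covers_decomposition_le => C cC.
exact: symbolic_power_sub sf m mf.
Qed.

(** Every monomial in the support is a multiple of a product of edges and cycle monomials, so an
    upper bound for the symbolic power has to be tested on such products only. *)
Lemma symbolic_power_min s J : is_ideal J ->
  (forall p q f, ((p + q) * (n + 1) <= s)%N ->
     idealX I (s - (p + q) * (n + 1)) f -> J (f * 'X_[mx] ^+ p * 'X_[my] ^+ q)) ->
  symbolic_power I s `<=` J.
Proof.
move=> JI Jmem f sf; apply: mpoly_mem => // m mf.
have [p [q [e [le_s [eI _] em]]]] := symbolic_power_supp sf mf.
apply: (lem_mem JI em); rewrite !mpolyXD -!mpolyXn; exact: Jmem.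
Qed.

Lemma symbolic_power_degree s d : nonzero_in_degree (symbolic_power I s) d ->
  exists p q, ((p + q) * (n + 1) <= s)%N /\
    (2 * (s - (p + q) * (n + 1)) + mdeg mx * p + mdeg my * q <= d)%N.
Proof.
move=> [f [sf /dhomogP fd f0]].
have [m mf] : exists m, m \in msupp f.
  by move: f0; rewrite -msupp_eq0; case: (msupp f) => // m r; exists m; rewrite inE eqxx.
have [p [q [e [le_s [_ eI] em]]]] := symbolic_power_supp sf mf.
exists p, q; split=> //; rewrite -(fd m mf) /= -(submK em) !mdegD !mdegMn.
by rewrite mul2n (leq_trans _ (leq_addl _ _)) // !leq_add2r.
Qed.

End CliqueSum.

(** * Initial degrees and the Waldschmidt constant *)

(** Only the indices [s.+1] are controlled, because at [s = 0] the quotient defining the Waldschmidt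
    constant divides by zero; the harmonic sequence does the squeezing. *)
Lemma cvg_dist_inv (R : realType) (u : nat -> R) (l : R) :
  (forall s, `|u s.+1 - l| <= s.+1%:R^-1) -> u s @[s --> \oo] --> l.
Proof.
move=> ul; rewrite -cvg_shiftS /=.
apply: (@squeeze_cvgr _ _ _ _ (fun s => l - harmonic s) (fun s => l + harmonic s)).
- by near=> s; have := ul s; rewrite ler_distl.
- rewrite -[X in _ --> X]subr0; apply: cvgB; [exact: cvg_cst | exact: cvg_harmonic].
- rewrite -[X in _ --> X]addr0; apply: cvgD; [exact: cvg_cst | exact: cvg_harmonic].
Unshelve. all: by end_near. Qed.

Lemma alphaE (N : nat) (K : fieldType) (J : set {mpoly K[N]}) d :
  nonzero_in_degree J d -> (forall e, nonzero_in_degree J e -> (d <= e)%N) ->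
  alpha J = d.
Proof.
move=> Jd dmin; rewrite /alpha; case: xgetP => [k _ [Jk kmin]|/(_ d)[]//].
by apply/eqP; rewrite eqn_leq kmin ?dmin.
Qed.

Lemma has_waldschmidt_constant_half (R : realType) (N : nat) (K : fieldType)
    (J : set {mpoly K[N]}) :
  (forall s, (1 <= s)%N -> alpha (symbolic_power J s) = (2 * s)%N) ->
  has_waldschmidt_constant J (2 : R).
Proof.
move=> aE; apply: cvg_dist_inv => s; rewrite aE // natrM mulfK ?pnatr_eq0 //.
by rewrite subrr normr0 invr_ge0 ler0n.
Qed.

Lemma has_waldschmidt_constant_floor (R : realType) (N n : nat) (K : fieldType)
    (J : set {mpoly K[N]}) :
  (forall s, (1 <= s)%N ->
     alpha (symbolic_power J s) = (2 * s - s %/ (n + 1))%N) ->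
  has_waldschmidt_constant J ((2 * n + 1)%:R / (n + 1)%:R : R).
Proof.
move=> aE; apply: cvg_dist_inv => s; rewrite aE //.
set k := (_ %/ _)%N; have s_eq := divn_eq s.+1 (n + 1).
rewrite -/k in s_eq; have r_lt : (s.+1 %% (n + 1) < n + 1)%N by rewrite ltn_mod addn1.
set r := (_ %% _)%N in s_eq r_lt.
(* Makes the truncated subtraction [2 * s.+1 - k] a genuine one. *)
have le_k : (k <= 2 * s.+1)%N by nia.
have S0 : 0 < s.+1%:R :> R by rewrite ltr0n.
have n0 : 0 < (n + 1)%:R :> R by rewrite ltr0n addn1.
(* With [s.+1 = k * (n + 1) + r] the error is [r / (n + 1)] divided by [s.+1], and [r < n + 1]. *)
have -> : (2 * s.+1 - k)%:R / s.+1%:R - (2 * n + 1)%:R / (n + 1)%:R =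
    (r%:R / (n + 1)%:R) / s.+1%:R :> R.
  have sE : s.+1%:R = k%:R * (n + 1)%:R + r%:R :> R by rewrite -natrM -natrD -s_eq.
  rewrite natrB // (natrM _ 2 s.+1).
  have -> : (2 * n + 1)%:R = 2 * (n + 1)%:R - 1 :> R by ring.
  move: S0 n0 sE; move: (s.+1%:R) ((n + 1)%:R) => S M S0 M0 SE.
  have -> : r%:R = S - k%:R * M by rewrite SE addrC addKr.
  field; apply/andP; split; exact: lt0r_neq0.
rewrite ger0_norm ?divr_ge0 ?ler0n // ler_pdivrMr // mulVf ?lt0r_neq0 //.
by rewrite ler_pdivrMr // mul1r ler_nat ltnW.
Qed.

Section Alpha.
Variables (K : fieldType) (V : finType) (D : weighted_oriented_graph V).
Variables (n : nat) (x y : 'I_(2 * n).+1 -> V).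
Hypothesis n_gt0 : (0 < n)%N.
Hypothesis DG : clique_sum_of_odd_cycles D x y.
Hypothesis Vplus_sink : forall v, v \in Vplus D -> sink D v.
Local Notation I := (edge_ideal K D).
Local Notation mx := (cycle_exponent D x).
Local Notation my := (cycle_exponent D y).

Lemma exists_edge_degree2 : exists u v, adj D u v /\ mdeg (phi D u + phi D v)%MM = 2%N.
Proof.
have [|u [v [uv wu wv]]] := exists_edge_notin_Vplus (z := x) Vplus_sink.
  by move=> i; case: DG => _ _ _ E; apply/E; left; exists i; left.
by exists u, v; split=> //; rewrite mdegD !mdeg_phi wu wv.
Qed.

Lemma symbolic_power_nonzero s p : (p * (n + 1) <= s)%N ->
  nonzero_in_degree (symbolic_power I s)
    (2 * (s - p * (n + 1)) + mdeg mx * p).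
Proof.
have [u [v [uv degE]]] := exists_edge_degree2 => le_s.
set k := (s - _)%N.
(* An edge between vertices of weight 1 has the least possible degree 2; its power is completed by
   [p] copies of the first cycle. *)
exists ('X_[(phi D u + phi D v) *+ k] * 'X_[mx] ^+ p * 'X_[my] ^+ 0); split.
- apply: symbolic_power_mem => //; rewrite addn0 //.
  by have [] := edge_power_muln k (edge_power_adj K Vplus_sink uv).
- rewrite expr0 mulr1 mpolyXn -mpolyXD dhomogX /=.
  by rewrite mdegD !mdegMn degE.
- by rewrite expr0 mulr1 mpolyXn -mpolyXD -msupp_eq0 msuppX.
Qed.

Lemma alpha_symbolic_power_one s : ~ (exists i, x i \in Vplus D) ->
  (exists i, y i \in Vplus D) ->
  alpha (symbolic_power I s) = (2 * s - s %/ (n + 1))%N.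
Proof.
move=> xN yP; have le_s : (s %/ (n + 1) * (n + 1) <= s)%N := leq_trunc_div _ _.
have mxE := mdeg_cycle_exponent_eq xN; have myE := mdeg_cycle_exponent_gt yP.
have n1 : (0 < n + 1)%N by rewrite addn1.
apply: alphaE => [|d /(symbolic_power_degree n_gt0 DG Vplus_sink)[p [q [le_pq]]]].
  (* A copy of the first cycle has degree [2 * n + 1] and replaces [n + 1] edges of total degree
     [2 * n + 2], saving one; as many copies as fit are used. *)
  have := symbolic_power_nonzero le_s; rewrite mxE.
  by congr nonzero_in_degree; nia.
(* At most [s %/ (n + 1)] copies of the first cycle fit, and the second cycle saves nothing. *)
have p_le : (p <= s %/ (n + 1))%N by rewrite leq_divRL //; nia.
apply: leq_trans; rewrite mxE; nia.
Qed.

Lemma alpha_symbolic_power_two s : (exists i, x i \in Vplus D) ->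
  (exists i, y i \in Vplus D) -> alpha (symbolic_power I s) = (2 * s)%N.
Proof.
move=> xP yP.
have mxE := mdeg_cycle_exponent_gt xP; have myE := mdeg_cycle_exponent_gt yP.
apply: alphaE => [|d /(symbolic_power_degree n_gt0 DG Vplus_sink)[p [q [le_pq]]]].
  (* Both cycle monomials have degree at least [2 * n + 2], so edges alone attain the minimum. *)
  have := @symbolic_power_nonzero s 0%N (leq0n _).
  by rewrite mul0n subn0 muln0 addn0.
by apply: leq_trans; nia.
Qed.

End Alpha.

(** * Symbolic powers, initial degrees and Waldschmidt constants of the clique sum *)

Theorem proposition3p12 (R : realType) (K : fieldType) (V : finType) (n : nat)
    (D : weighted_oriented_graph V) (x y : 'I_(2 * n).+1 -> V)
    (n_gt0 : (0 < n)%N)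
    (DG : clique_sum_of_odd_cycles D x y)
    (Vplus_neq0 : exists v, v \in Vplus D)
    (Vplus_sink : forall v, v \in Vplus D -> sink D v) :
  let I := edge_ideal K D in
  let c := cycle_monomial K D x in
  let c' := cycle_monomial K D y in
  let x_meets := exists i, x i \in Vplus D in
  let y_meets := exists i, y i \in Vplus D in
  [/\ (forall s : nat, (1 <= s <= n)%N -> symbolic_power I s = idealX I s) /\
      symbolic_power I (n + 1) =
        idealD (idealD (idealX I (n + 1)) (principal c)) (principal c'),

      forall s k r : nat, (1 <= s)%N -> s = (k * (n + 1) + r)%N -> (r <= n)%N ->
        symbolic_power I s =
          \big[@idealD _/[set 0]]_(t < k.+1)
            \big[@idealD _/[set 0]]_(p < t.+1)
              \big[@idealD _/[set 0]]_(q < t.+1 | (p + q == t)%N)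
                idealM (idealM (idealX I (s - t * (n + 1)))
                               (idealX (principal c) p))
                       (idealX (principal c') q),

      (~ x_meets /\ y_meets) \/ (x_meets /\ ~ y_meets) ->
        (forall s : nat, (1 <= s)%N ->
           alpha (symbolic_power I s) = (2 * s - s %/ (n + 1))%N) /\
        has_waldschmidt_constant I ((2 * n + 1)%:R / (n + 1)%:R : R) &

      x_meets /\ y_meets ->
        (forall s : nat, (1 <= s)%N -> alpha (symbolic_power I s) = (2 * s)%N) /\
        has_waldschmidt_constant I (2 : R)].
Proof.
move=> I c c' x_meets y_meets.
have cE : c = 'X_[cycle_exponent D x] by apply: cycle_monomialE; case: DG => -[].
have c'E : c' = 'X_[cycle_exponent D y] by apply: cycle_monomialE; case: DG => -[].
have symI s : is_ideal (symbolic_power I s) := symbolic_power_ideal I s.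
have sym_mem s p q f : ((p + q) * (n + 1) <= s)%N ->
    idealX I (s - (p + q) * (n + 1)) f -> symbolic_power I s (f * c ^+ p * c' ^+ q).
  by rewrite cE c'E; apply: symbolic_power_mem.
have sym_min s J : is_ideal J -> (forall p q f, ((p + q) * (n + 1) <= s)%N ->
    idealX I (s - (p + q) * (n + 1)) f -> J (f * c ^+ p * c' ^+ q)) ->
    symbolic_power I s `<=` J.
  by rewrite cE c'E; apply: (symbolic_power_min n_gt0 DG Vplus_sink).
have powI s : idealX I s `<=` symbolic_power I s.
  by move=> f fI; have := sym_mem s 0%N 0%N f; rewrite subn0 !mulr1; apply.
split; first split.
- move=> s /andP[_ s_le]; apply/seteqP; split; last exact: powI.
  apply: sym_min => [|p q f pq_le]; first exact: idealX_ideal.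
  (* Below [n + 1] no cycle fits, so only edges remain. *)
  have [-> ->] : p = 0%N /\ q = 0%N by nia.
  by rewrite subn0 !mulr1.
- have cI := ideal_gen_ideal [set c]; have c'I := ideal_gen_ideal [set c'].
  have XI := idealX_ideal I (n + 1); have XcI := idealD_ideal XI cI.
  have symc p q : (p + q = 1)%N -> symbolic_power I (n + 1) (c ^+ p * c' ^+ q).
    by move=> pq; have := sym_mem (n + 1)%N p q 1; rewrite pq mul1n subnn mul1r; apply.
  apply/seteqP; split.
    apply: sym_min => [|p q f pq_le fI]; first exact: idealD_ideal.
    (* At most one cycle fits: the three remaining cases are the three summands. *)
    case: p q => [|[|p]] [|[|q]] in pq_le fI *; try by nia.
    + apply: idealDl; first by case: c'I.
      by apply: idealDl; [case: cI | move: fI; rewrite subn0 !mulr1].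
    + apply: idealDr; first by case: XcI.
      by apply/principalP; exists f; rewrite mulr1.
    + apply: idealDl; first by case: c'I.
      apply: idealDr; first by case: XI.
      by apply/principalP; exists f; rewrite mulr1.
  apply: idealD_min => //; first apply: idealD_min => //.
  + move=> f /principalP[h ->]; apply: (idealMl _ (symI _)).
    by have := symc 1%N 0%N erefl; rewrite mulr1.
  + move=> f /principalP[h ->]; apply: (idealMl _ (symI _)).
    by have := symc 0%N 1%N erefl; rewrite mul1r.
- move=> s k r _ sE r_le.
  have idM A B C : is_ideal (idealM (idealM (A : set {mpoly K[#|V|]}) B) C).
    exact: ideal_gen_ideal.
  apply/seteqP; split.
    apply: sym_min => [|p q f pq_le fI].
      by apply: big_idealD_ideal => t _; apply: big_idealD_ideal => p _;
        apply: big_idealD_ideal.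
    (* The product lies in the summand [t = p + q], with inner indices [p] and [q]. *)
    have tk : (p + q < k.+1)%N by nia.
    have pt : (p < (p + q).+1)%N by lia.
    have qt : (q < (p + q).+1)%N by lia.
    apply: (@big_idealD_mem _ _ _ _ _ (Ordinal tk)) => //.
    + by move=> t _; apply: big_idealD_ideal => i _; apply: big_idealD_ideal.
    + exact: mem_index_enum.
    apply: (@big_idealD_mem _ _ _ _ _ (Ordinal pt)) => //.
    + by move=> i _; apply: big_idealD_ideal.
    + exact: mem_index_enum.
    apply: (@big_idealD_mem _ _ _ _ _ (Ordinal qt)) => //.
    + exact: mem_index_enum.
    + by apply: idealM_mem; [apply: idealM_mem => // |]; apply: idealX_exp;
        apply: sub_ideal_gen.
  apply: big_idealD_min => // t _; apply: big_idealD_min => // p _.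
  apply: big_idealD_min => // q /eqP pq; apply: idealM_min => //.
  (* The factor from the power of [(c')] is fixed first; the colon ideal then reduces the other
     factor to products. *)
  move=> f g fI /idealX_principal[h ->].
  move: f fI; apply: (@idealM_min _ _ _ [set f | symbolic_power I s (f * (h * c' ^+ q))]).
    exact: is_ideal_colon.
  move=> f g' fI /idealX_principal[h' ->] /=.
  have -> : f * (h' * c ^+ p) * (h * c' ^+ q) = h' * h * (f * c ^+ p * c' ^+ q).
    by ring.
  apply: (idealMl _ (symI _)); apply: sym_mem; rewrite pq //.
  by have := ltn_ord t; nia.
- move=> xy_meets.
  have aE s : alpha (symbolic_power I s) = (2 * s - s %/ (n + 1))%N.
    (* The clique sum is symmetric in the two cycles, so the second case swaps them. *)
    case: xy_meets => -[mx my].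
      exact: (alpha_symbolic_power_one K n_gt0 DG Vplus_sink s mx my).
    exact: (alpha_symbolic_power_one K n_gt0 (clique_sum_sym DG) Vplus_sink s my mx).
  by split=> [s _|] //; apply: has_waldschmidt_constant_floor.
- move=> [mx my].
  have aE s : alpha (symbolic_power I s) = (2 * s)%N.
    exact: (alpha_symbolic_power_two K n_gt0 DG Vplus_sink s mx my).
  by split=> [s _|] //; apply: has_waldschmidt_constant_half.
Qed.
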